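(* Let $m$ be an even positive integer and let $\mathcal{A}=(a_{i_1i_2\cdots i_m})$ be a real centrosymmetric tensor of order $m$ and dimension $3$. Then $$\lambda=\sum_{i_2,\dots,i_m\in\{1,3\}}a_{1i_2\cdots i_m}(-1)^{r(i_2\cdots i_m)}$$ is an H-eigenvalue of $\mathcal{A}$ with a skew symmetric H-eigenvector, where $r(i_2\cdots i_m)$ denotes the number of indices among $i_2,\dots,i_m$ that are equal to $3$.
   Context: A real tensor of order $m$ and dimension $n$ is an array $\mathcal{A}=(a_{i_1\cdots i_m})$ of reals with $i_1,\dots,i_m\in[n]=\{1,\dots,n\}$. It is centrosymmetric if $a_{i_1\cdots i_m}=a_{n-i_1+1,\dots,n-i_m+1}$ for all indices. For $x\in\mathbb{R}^n$, $\mathcal{A}x^{m-1}\in\mathbb{R}^n$ has $i$-th component $\sum_{i_2,\dots,i_m=1}^n a_{ii_2\cdots i_m}x_{i_2}\cdots x_{i_m}$, and $x^{[m-1]}=(x_1^{m-1},\dots,x_n^{m-1})$. If $\lambda\in\mathbb{R}$ and $x\in\mathbb{R}^n\setminus\{0\}$ satisfy $\mathcal{A}x^{m-1}=\lambda x^{[m-1]}$, then $\lambda$ is an H-eigenvalue of $\mathcal{A}$ and $x$ a corresponding H-eigenvector. A vector $x\in\mathbb{R}^n$ is skew symmetric if $x_{n-i+1}=-x_i$ for all $i\in[n]$. *)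

(* Defs.v *)
From HB Require Import structures.
From mathcomp Require Import all_boot all_order all_algebra.
From mathcomp Require Import reals.

Set Implicit Arguments.
Unset Strict Implicit.
Unset Printing Implicit Defensive.

Import Order.TTheory GRing.Theory Num.Theory.
Local Open Scope ring_scope.

(* Indices are 0-based ('I_n = {0, ..., n - 1}), so the reflection
   i |-> n - i + 1 of {1, ..., n} is rev_ord. *)

Definition tensor (R : realType) (m n : nat) := {ffun m.-tuple 'I_n -> R}.

Definition centrosymmetric (R : realType) (m n : nat) (A : tensor R m n) : Prop :=
  forall t : m.-tuple 'I_n, A t = A [tuple of map (@rev_ord n) t].

(* A tensor of positive order is given order m.+1, so that the exponent of the
   contraction A x^(order - 1) is m; the tuple t lists the last m indices. *)
Definition tensor_app (R : realType) (m n : nat) (A : tensor R m.+1 n)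
    (x : 'rV[R]_n) : 'rV[R]_n :=
  \row_i \sum_(t : m.-tuple 'I_n) A [tuple of i :: t] * \prod_(j <- t) x 0 j.

Definition entrywise_pow (R : realType) (n : nat) (x : 'rV[R]_n) (k : nat) :
    'rV[R]_n :=
  \row_i x 0 i ^+ k.

Definition H_eigenpair (R : realType) (m n : nat) (A : tensor R m.+1 n)
    (lambda : R) (x : 'rV[R]_n) : Prop :=
  x != 0 /\ tensor_app A x = lambda *: entrywise_pow x m.

Definition skew_symmetric (R : realType) (n : nat) (x : 'rV[R]_n) : Prop :=
  forall i : 'I_n, x 0 (rev_ord i) = - x 0 i.

(* Main.v *)
(* Contracting a centrosymmetric tensor of even order with a skew symmetric vector
   gives a skew symmetric vector, and a skew symmetric vector of R^3 is
   determined by its first entry. So with x = (1, 0, -1) the eigenvalue equation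
   only has to be checked at the first index, where it reads off lambda. *)
Require Import Defs.
From HB Require Import structures.
From mathcomp Require Import all_boot all_order all_algebra.
From mathcomp Require Import reals.

Set Implicit Arguments.
Unset Strict Implicit.
Unset Printing Implicit Defensive.

Import Order.TTheory GRing.Theory Num.Theory.
Local Open Scope ring_scope.

(** Reflecting every summation index permutes the tuples [t]. Centrosymmetry then restores the
    coefficient at [i :: t], and the product of [m] entries of [x] gains the sign [(-1) ^+ m], which
    is [-1] for odd [m]. *)
Lemma tensor_app_skew (R : realType) (m n : nat) (A : tensor R m.+1 n)
    (x : 'rV[R]_n) :
  odd m -> centrosymmetric A -> skew_symmetric x ->
  skew_symmetric (tensor_app A x).
Proof.
move=> odd_m hA hx i; rewrite !mxE -sumrN.
pose rv (t : m.-tuple 'I_n) := [tuple of map (@rev_ord n) t].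
have rvK : involutive rv.
  by move=> t; apply: val_inj; rewrite /= mapK //; apply: rev_ordK.
rewrite (reindex_inj (inv_inj rvK)) /=; apply: eq_bigr => t _.
have -> : A [tuple of rev_ord i :: rv t] = A [tuple of i :: t].
  by rewrite [RHS]hA; congr (A _); apply: val_inj.
rewrite -mulrN; congr (_ * _); rewrite big_map.
rewrite (eq_bigr (fun j => -1 * x 0 j)) => [|j _]; last by rewrite hx mulN1r.
rewrite big_split big_const_seq count_predT size_tuple iter_mulr_1 /=.
by rewrite -signr_odd odd_m mulN1r.
Qed.

Lemma entrywise_pow_skew (R : realType) (n k : nat) (c : R) (x : 'rV[R]_n) :
  odd k -> skew_symmetric x -> skew_symmetric (c *: entrywise_pow x k).
Proof.
by move=> odd_k hx i; rewrite !mxE hx exprNn -signr_odd odd_k mulN1r mulrN.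
Qed.

Lemma skew_symmetric3_eq (R : realType) (y z : 'rV[R]_3) :
  skew_symmetric y -> skew_symmetric z -> y 0 ord0 = z 0 ord0 -> y = z.
Proof.
(* An entry at an index fixed by the reflection equals its own negative; this handles the middle
   index. *)
have mid0 (u : 'rV[R]_3) (i : 'I_3) :
    skew_symmetric u -> rev_ord i = i -> u 0 i = 0.
  by move=> hu ri; apply/eqP; rewrite -eqNr -hu ri.
move=> hy hz yz0; apply/rowP=> -[[|[|[|//]]] lti].
- by rewrite (_ : Ordinal lti = ord0) //; apply: val_inj.
- by rewrite !mid0 //; apply: val_inj.
- by rewrite (_ : Ordinal lti = rev_ord ord0) ?hy ?hz ?yz0 //; apply: val_inj.
Qed.

Definition skew_vec3 (R : realType) : 'rV[R]_3 :=
  \row_j (if j == ord0 then 1 else if j == ord_max then -1 else 0).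

Lemma skew_vec3_skew (R : realType) : skew_symmetric (skew_vec3 R).
Proof. by move=> [[|[|[|//]]] lti]; rewrite !mxE ?opprK ?oppr0. Qed.

(** The zero middle entry kills any product that meets it, and each [ord_max] contributes a factor
    [-1]: hence the index restriction and the sign in the eigenvalue. *)
Lemma prod_skew_vec3 (R : realType) (s : seq 'I_3) :
  \prod_(j <- s) skew_vec3 R 0 j =
  if all (mem [:: ord0; ord_max]) s then (-1) ^+ count_mem ord_max s else 0.
Proof.
elim: s => [|j s IHs]; first by rewrite big_nil.
rewrite big_cons IHs mxE /= !inE.
have [->|_] /= := eqVneq j ord0; first by rewrite mul1r.
have [_|_] /= := eqVneq j ord_max; last by rewrite mul0r.
by case: all; rewrite ?exprS ?mulr0.
Qed.

Theorem theorem4p2 (R : realType) (m : nat) (hm : ~~ odd m.+1)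
    (A : tensor R m.+1 3) (hA : centrosymmetric A) :
  exists x : 'rV[R]_3,
    H_eigenpair A
      (\sum_(t : m.-tuple 'I_3 | all (mem [:: ord0; ord_max]) t)
         A [tuple of ord0 :: t] * (-1) ^+ count_mem ord_max t) x
    /\ skew_symmetric x.
Proof.
have odd_m : odd m by rewrite -[odd m]negbK.
have hx := skew_vec3_skew R.
exists (skew_vec3 R); split=> //; split.
  by apply/eqP => /rowP /(_ ord0) /eqP; rewrite !mxE oner_eq0.
apply: skew_symmetric3_eq; first exact: tensor_app_skew.
  exact: entrywise_pow_skew.
(* The first entry of the vector is 1, so the right side is the eigenvalue itself, extended by zero
   terms to a sum over all tuples. *)
rewrite !mxE /= expr1n mulr1 [RHS]big_mkcond /=; apply: eq_bigr => t _.
by rewrite prod_skew_vec3; case: ifP => _; rewrite ?mulr0.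
Qed.
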